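(* Let $G$ be a 2-edge-connected graph with DFS tree $T$ rooted at $r$ and chain decomposition $C_1,C_2,\ldots$, such that $C_1\cup C_2$ is a subdivision of the graph with two vertices and three parallel edges, with branch vertices $r$ and $t(C_2)$. Let $G_c$ be a parent-closed union of chains containing $C_1$ and $C_2$ such that no chain that is not in $G_c$ but whose parent chain is in $G_c$ is a Mader-path with respect to $G_c$, and suppose there is at least one chain not in $G_c$ whose parent chain is in $G_c$. Then for every link of $G_c$ with at least two edges, its first and last edge form a 2-edge-cut of $G$ (their removal disconnects $G$).
   Context: Graphs are finite, undirected, may have parallel edges, no self-loops, and (standing convention) minimum degree at least three. $T$ is a DFS tree of $G$ rooted at $r$; $x\le y$ means $x$ lies on the tree path from $r$ to $y$; $p(v)$ is the parent of $v\ne r$. Non-tree edges (back-edges) join a vertex to a proper ancestor; a back-edge $\{x,y\}$ with $x<y$ is oriented from $x$ to $y$. Chain decomposition: processing vertices $v$ in DFS discovery order, declare $v$ visited, then for each back-edge from $v$ to $w$ walk the tree path from $w$ towards $r$ until the first visited vertex $x$; the back-edge plus the tree path from $w$ to $x$ is a chain $C$ with $s(C)=v$, $t(C)=x$; its inner vertices are declared visited. Chains are numbered in construction order and partition $E(G)$ when $G$ is 2-edge-connected. $r$ s-belongs to $C_1$; $v\ne r$ s-belongs to the chain containing $\{v,p(v)\}$. The parent $p(C)$ of a chain $C\ne C_1$ is the chain to which $t(C)$ s-belongs. A union of chains $G_c$ is parent-closed if for every chain $C\ne C_1$ in $G_c$, $p(C)$ is in $G_c$. Branch vertices of a graph $H$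 are those of degree at least three in $H$; a link of $H$ is a maximal path whose inner vertices have degree two in $H$. An ear of $H$ is a path whose endpoints lie in $H$ and whose inner vertices and edges are not in $H$. A Mader-path with respect to $H$ is an ear of $H$ whose two endpoints are not both inner vertices of the same link of $H$. *)

(* Defs.v *)
From mathcomp Require Import all_boot.

Set Implicit Arguments.
Unset Strict Implicit.
Unset Printing Implicit Defensive.

(* Parallel edges are distinct elements of [edge] with the same ends; the
   cardinality condition rules out self-loops. *)
Record mgraph := MGraph {
  vertex : finType;
  edge : finType;
  ends : edge -> {set vertex};
  card_ends : forall e, #|ends e| = 2
}.

(* Subgraphs without isolated vertices are represented by their edge sets. *)
Section Subgraphs.
Variable G : mgraph.
Implicit Types (F : {set edge G}) (u v : vertex G) (e : edge G).

Definition verts F : {set vertex G} := \bigcup_(e in F) ends e.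

Definition deg F v : nat := #|[set e in F | v \in ends e]|.

Definition adj F : rel (vertex G) :=
  [rel u v | [exists e in F, ends e == [set u; v]]].

(* Connectedness of the spanning subgraph of G with edge set F. *)
Definition spanning_connected F : Prop := forall u v, connect (adj F) u v.

Definition edge_connected (k : nat) : Prop :=
  1 < #|vertex G| /\
  forall F, #|F| < k -> spanning_connected (~: F).

Definition two_edge_cut e1 e2 : Prop :=
  e1 <> e2 /\ ~ spanning_connected (~: [set e1; e2]).

Definition min_degree_ge (k : nat) : Prop := forall v, k <= deg [set: edge G] v.

End Subgraphs.

Section Paths.
Variable G : mgraph.

(* (x, [:: (e1, x1); ...; (en, xn)]) stands for x -e1- x1 -e2- ... -en- xn. *)
Definition walk : Type := (vertex G * seq (edge G * vertex G))%type.

Implicit Types (P Q : walk) (F : {set edge G}) (v : vertex G).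

Fixpoint walk_from v (p : seq (edge G * vertex G)) : bool :=
  if p is (e, w) :: p' then (ends e == [set v; w]) && walk_from w p' else true.

Definition is_walk P : bool := walk_from P.1 P.2.

Definition wstart P : vertex G := P.1.
Definition wend P : vertex G := last P.1 (unzip2 P.2).
Definition wedges P : seq (edge G) := unzip1 P.2.
Definition winner P : seq (vertex G) := behead (belast P.1 (unzip2 P.2)).

(* Paths have at least one edge, and their two endpoints may coincide: chains
   can be cycles, and Mader's operations may create subdivided self-loops, so
   closed ears and closed links have to be covered. No other repetition of
   vertices or edges is allowed. *)
Definition is_path P : bool :=
  [&& is_walk P, P.2 != [::], uniq (wedges P),
      uniq (belast P.1 (unzip2 P.2)) & uniq (unzip2 P.2)].

Definition link_like F P : Prop :=
  [/\ is_path P, {subset wedges P <= F}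
    & {in winner P, forall v, deg F v = 2}].

(* Maximality is with respect to inclusion of edge sets. *)
Definition link F P : Prop :=
  link_like F P /\
  forall Q, link_like F Q -> {subset wedges P <= wedges Q} ->
    {subset wedges Q <= wedges P}.

Definition ear F P : Prop :=
  [/\ is_path P, wstart P \in verts F /\ wend P \in verts F,
      {in winner P, forall v, v \notin verts F}
    & {in wedges P, forall e, e \notin F}].

Definition mader_path F P : Prop :=
  ear F P /\
  ~ (exists2 L, link F L & wstart P \in winner L /\ wend P \in winner L).

(* The subgraph F of G is a subdivision of K, the vertex x of K being placed
   at b x and the edge k of K being replaced by the path P k. *)
Definition subdivision (K : mgraph) F (b : vertex K -> vertex G) : Prop :=
  injective b /\ exists P : edge K -> walk,
  [/\ forall k, is_path (P k) /\
        exists x y, [/\ ends k = [set x; y], wstart (P k) = b x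
                      & wend (P k) = b y],
      forall k x, b x \notin winner (P k),
      forall k l, k != l ->
        [disjoint winner (P k) & winner (P l)] /\
        [disjoint wedges (P k) & wedges (P l)]
    & forall e, e \in F <-> exists k, e \in wedges (P k)].

End Paths.

Lemma theta_card_ends (k : 'I_3) : #|[set: bool]| = 2.
Proof. by rewrite cardsT card_bool. Qed.

(* Two vertices joined by three parallel edges. *)
Definition theta : mgraph := MGraph theta_card_ends.

Section DFS.
Variable G : mgraph.
Implicit Types (v w : vertex G) (e : edge G).

(* Rooted trees: up v = Some (e, u) when u is the parent of v, reached through
   the tree edge e, and up r = None. *)
Definition forest : Type := vertex G -> option (edge G * vertex G).

(* dfs_run r stack disc up: the state (stack, list of the discovered vertices
   in order of discovery, tree built so far) can be reached by a depth-first
   search from r, the edges at each vertex being explored in any order. *)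
Inductive dfs_run (r : vertex G) :
  seq (vertex G) -> seq (vertex G) -> forest -> Prop :=
| dfs_start : dfs_run r [:: r] [:: r] (fun _ => None)
| dfs_discover v s d up e w :
    dfs_run r (v :: s) d up -> ends e = [set v; w] -> w \notin d ->
    dfs_run r (w :: v :: s) (rcons d w)
      (fun x => if x == w then Some (e, v) else up x)
| dfs_backtrack v s d up :
    dfs_run r (v :: s) d up ->
    (forall e w, ends e = [set v; w] -> w \in d) ->
    dfs_run r s d up.

Definition dfs_tree (r : vertex G) (disc : seq (vertex G)) (up : forest) :=
  dfs_run r [::] disc up.

Variable up : forest.

Fixpoint climb (n : nat) v : seq (edge G * vertex G) :=
  if n is n'.+1 then
    if up v is Some (e, u) then (e, u) :: climb n' u else [::]
  else [::].

(* The tree path from v to the root; it has fewer than #|V| edges. *)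
Definition root_path v := climb #|vertex G| v.

Definition ancestor v w : bool := v \in w :: unzip2 (root_path w).

Definition tree_edge e : bool := [exists v, omap fst (up v) == Some e].

(* e is a back-edge oriented from v to w, where v < w. *)
Definition back_edge v e w : bool :=
  [&& ~~ tree_edge e, ends e == [set v; w], v != w & ancestor v w].

(* bk v lists the back-edges from v (with their heads), in the order in which
   they are processed. *)
Definition back_edge_lists (bk : vertex G -> seq (edge G * vertex G)) : Prop :=
  forall v, uniq (bk v) /\ forall e w, ((e, w) \in bk v) = back_edge v e w.

Implicit Type st : {set vertex G} * seq (walk G).

(* The chain consisting of the back-edge ew = (e, w) from v and of the tree
   path from w up to the first vertex in vis. *)
Definition make_chain (vis : {set vertex G}) v (ew : edge G * vertex G) :
    walk G :=
  let rp := root_path ew.2 in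
  (v, ew :: take (find (mem vis) (ew.2 :: unzip2 rp)) rp).

(* States are pairs (visited vertices, chains constructed so far). *)
Definition process_back_edge v st (ew : edge G * vertex G) :=
  let C := make_chain st.1 v ew in
  (st.1 :|: [set u in winner C], rcons st.2 C).

Definition process_vertex (bk : vertex G -> seq (edge G * vertex G)) st v :=
  foldl (process_back_edge v) (v |: st.1, st.2) (bk v).

Definition chain_decomposition (disc : seq (vertex G))
    (bk : vertex G -> seq (edge G * vertex G)) : seq (walk G) :=
  (foldl (process_vertex bk) (set0, [::]) disc).2.

(* In what follows C1 is the first chain and cs the list of all chains. *)
Definition s_belongs (r : vertex G) (C1 : walk G) v (C : walk G) : Prop :=
  if v == r then C = C1
  else exists e u, up v = Some (e, u) /\ e \in wedges C.

Definition is_parent_chain (r : vertex G) (C1 : walk G) (cs : seq (walk G))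
    (C D : walk G) : Prop :=
  [/\ C <> C1, D \in cs & s_belongs r C1 (wend C) D].

Definition parent_in (r : vertex G) (C1 : walk G) (cs Gc : seq (walk G))
    (C : walk G) : Prop :=
  exists2 D, D \in Gc & is_parent_chain r C1 cs C D.

Definition parent_closed (r : vertex G) (C1 : walk G) (cs Gc : seq (walk G)) :
    Prop :=
  forall C, C \in Gc -> C <> C1 -> parent_in r C1 cs Gc C.

(* A chain outside Gc whose parent is in Gc. *)
Definition child_chain (r : vertex G) (C1 : walk G) (cs Gc : seq (walk G))
    (C : walk G) : Prop :=
  [/\ C \in cs, C \notin Gc & parent_in r C1 cs Gc C].

Definition union_of (Gc : seq (walk G)) : {set edge G} :=
  [set e | has (fun C => e \in wedges C) Gc].

End DFS.

(* Main.v *)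
Require Import Defs.
From mathcomp Require Import all_boot.

(** Let [F] be the edge set of [Gc] and [W] its vertex set. Parent-closedness
makes [W] an ancestor-closed subtree whose tree edges all lie in [F], so every
chain outside [Gc] that ends in [W] is an ear of [F]; as it is not a Mader-path,
its ends are joined by a walk of [F] through vertices of degree two. The root
has degree at least three, which forces the tree path between two such ends to
consist of vertices of degree two as well.

Send every vertex [y] to its nearest ancestor [top y] in [W]. The inner vertices
[S] of a link are closed under adjacency in [F] between vertices of degree two,
by maximality of the link, and the set of all [y] with [top y] in [S] is left
only by the first and last edge of the link. The critical case is a back-edge
[x -> y] outside [F] with [x] in [W] and [y] outside: the tree edge leading down
from [top y] towards [y] lies in a chain that ends in [top y] and that started
at or above [x], so [x] lies on the tree path between the ends of that chain. *)

Set Implicit Arguments.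
Unset Strict Implicit.
Unset Printing Implicit Defensive.

Lemma set2_inj (T : finType) (x y u v : T) : [set x; y] = [set u; v] ->
  (x = u /\ y = v) \/ (x = v /\ y = u).
Proof.
move=> E; have ux := set21 u v; have vx := set22 u v.
have := set21 x y; have := set22 x y; rewrite E; rewrite -E in ux vx.
move: ux vx; rewrite !inE.
by do 4 ! [case/orP=> /eqP ?]; subst; auto.
Qed.

Lemma ends_neq (G : mgraph) (e : edge G) x y : ends e = [set x; y] -> x != y.
Proof. by move=> E; have := card_ends e; rewrite E cards2; case: eqP. Qed.

(** * Ancestors in a rooted forest *)

Section Ancestors.
Variables (G : mgraph) (up : forest G).
Implicit Types (x y z v : vertex G).

(* Unlike [ancestor], this does not bound the length of the climb, so it can
   also be used for the partial trees built during the search. *)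
Inductive anc x : vertex G -> Prop :=
| anc_refl : anc x x
| anc_up y e u : up y = Some (e, u) -> anc x u -> anc x y.

Lemma anc_trans x y z : anc x y -> anc y z -> anc x z.
Proof.
move=> xy; elim=> // {}z e u upz _ xu; exact: anc_up upz xu.
Qed.

Lemma anc_inv x y : anc x y ->
  x = y \/ exists e u, up y = Some (e, u) /\ anc x u.
Proof. by case=> [|z e u ? ?]; [left | right; exists e, u]. Qed.

Lemma anc_total x y z : anc x z -> anc y z -> anc x y \/ anc y x.
Proof.
move=> xz; elim: xz y => [y|{}z e u upz xu IH y]; first by right.
case/anc_inv=> [->|[e' [u']]].
  by left; apply: anc_up upz xu.
by rewrite upz => -[[_ <-] yu]; apply: IH.
Qed.

Lemma anc_child x y : anc x y -> x <> y ->
  exists c e, up c = Some (e, x) /\ anc c y.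
Proof.
elim=> [//|{}y e u upy xu IH _].
have [Exu|/eqP xNu] := eqVneq x u.
  by exists y, e; split; [rewrite upy Exu | apply: anc_refl].
have [c [e' [upc cu]]] := IH xNu.
by exists c, e'; split=> //; apply: anc_up upy cu.
Qed.

End Ancestors.

Lemma anc_mono (G : mgraph) (up up' : forest G) x y :
  (forall v e u, up v = Some (e, u) -> up' v = Some (e, u)) ->
  anc up x y -> anc up' x y.
Proof.
move=> sub; elim=> [|{}y e u /sub upy _ xu]; first exact: anc_refl.
exact: anc_up upy xu.
Qed.

(** * Depth-first search and the normality of its tree *)

Section DFSRun.
Variables (G : mgraph) (r : vertex G).

Definition parent_rel (up : forest G) : rel (vertex G) :=
  fun v w => omap snd (up v) == Some w.

(** Meant for the search stack, which is a tree path listed upwards from its top [v]. *)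
Lemma stack_anc (up : forest G) v s x :
  sorted (parent_rel up) (v :: s) -> x \in v :: s -> anc up x v.
Proof.
elim: s v => [|w s IH] v /=; first by rewrite inE => _ /eqP->; apply: anc_refl.
case/andP; rewrite /parent_rel; case upv: (up v) => [[e u]|] //= /eqP[Eu] ps.
rewrite inE => /predU1P[->|xs]; first exact: anc_refl.
by rewrite Eu in upv; apply: anc_up upv _; apply: IH.
Qed.

Record dfs_inv (s d : seq (vertex G)) (up : forest G) : Prop := DfsInv {
  dfs_uniq : uniq d;
  dfs_stack : {subset s <= d};
  dfs_root : r \in d;
  dfs_uproot : up r = None;
  dfs_some v e u : up v = Some (e, u) ->
    [/\ ends e = [set v; u], v \in d, u \in d & index u d < index v d];
  dfs_none v : v \in d -> up v = None -> v = r;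
  dfs_sorted : sorted (parent_rel up) s;
  dfs_finished v e w : v \in d -> v \notin s -> ends e = [set v; w] -> w \in d;
  dfs_comparable e x y : x \in d -> y \in d -> ends e = [set x; y] ->
    anc up x y \/ anc up y x
}.

(** The point is [dfs_comparable]. A discovered neighbour of the new vertex [w] cannot have left the
    stack, since [dfs_finished] would then make [w] discovered already; so it is on the stack, which
    is the tree path above [w]. *)
Lemma dfs_runP s d up : dfs_run r s d up -> dfs_inv s d up.
Proof.
elim=> {s d up} [|v s d up e w _ I vw wNd|v s d up _ I nbrs].
- split=> // [|v|v e w|e x y]; rewrite ?inE ?eqxx //.
  + by move/eqP.
  + by move=> /eqP->; rewrite eqxx.
  + by move=> /eqP-> /eqP->; left; apply: anc_refl.
- have upw : up w = None.
    by case upw: (up w) => [[e' u]|//]; case: (dfs_some I upw); rewrite (negPf wNd).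
  set up' := fun _ => _.
  have sub x f u : up x = Some (f, u) -> up' x = Some (f, u).
    by rewrite /up'; case: eqP => // ->; rewrite upw.
  have vd : v \in d by apply: (dfs_stack I); rewrite inE eqxx.
  have srt : sorted (parent_rel up') (w :: v :: s).
    rewrite /= {1}/parent_rel {1}/up' eqxx /= eqxx /=.
    apply: sub_sorted (dfs_sorted I) => x y; rewrite /parent_rel.
    by case upx: (up x) => [[f u]|] //; rewrite (sub _ _ _ upx).
  have new f y : y \in d -> ends f = [set y; w] -> anc up' y w.
    move=> yd yw; apply: stack_anc srt _; rewrite inE; apply/orP; right.
    by apply: contraR wNd => yNs; apply: (dfs_finished I) yd yNs yw.
  split=> //.
  + by rewrite rcons_uniq wNd (dfs_uniq I).
  + by move=> x; rewrite inE mem_rcons inE => /orP[->//|/(dfs_stack I) ->]; rewrite orbT.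
  + by rewrite mem_rcons inE (dfs_root I) orbT.
  + rewrite /up'; case: eqP => [Er|_]; last exact: dfs_uproot I.
    by move: wNd; rewrite -Er (dfs_root I).
  + move=> x f u; rewrite /up'; case: eqP => [->|/eqP xw].
      case=> <- <-; rewrite vw setUC !mem_rcons !inE eqxx vd orbT; split=> //.
      by rewrite -!cats1 !index_cat vd (negPf wNd) /= eqxx addn0 index_mem.
    case/(dfs_some I) => xu xd ud lt; rewrite !mem_rcons !inE xd ud !orbT.
    by rewrite -!cats1 !index_cat xd ud.
  + move=> x; rewrite mem_rcons inE /up'; case: eqP => //= _ xd.
    exact: dfs_none I x xd.
  + move=> x f y; rewrite !mem_rcons [x \in w :: d]inE [x \in w :: _]inE negb_or.
    case/predU1P=> [->|xd]; first by rewrite eqxx.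
    by case/andP=> _ xNs xy; rewrite inE (dfs_finished I xd xNs xy) orbT.
  + move=> f x y; rewrite !mem_rcons !inE => /predU1P[->|xd] /predU1P[->|yd].
    * by left; apply: anc_refl.
    * by rewrite setUC => /(new _ _ yd); right.
    * by move/(new _ _ xd); left.
    * by move/(dfs_comparable I xd yd)=> [] /(anc_mono sub); auto.
- case: I => u ss dr ur us un srt fin cmp; split=> //.
  + by move=> x xs; apply: ss; rewrite inE xs orbT.
  + exact: path_sorted srt.
  + move=> x e w xd xNs xw; have [Ex|xv] := eqVneq x v.
      by apply: (nbrs e); rewrite -Ex.
    by apply: fin xd _ xw; rewrite inE negb_or xv.
Qed.

End DFSRun.
(** The interface to the search: all edges of [G] join comparable vertices, and positions drop
    towards the root, which makes [pos] a measure for climbing. *)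
Record normal_tree (G : mgraph) (r : vertex G) (pos : vertex G -> nat)
    (up : forest G) : Prop := NormalTree {
  up_ends v e u : up v = Some (e, u) -> ends e = [set v; u];
  up_pos v e u : up v = Some (e, u) -> pos u < pos v;
  up_root : up r = None;
  up_none v : up v = None -> v = r;
  edge_comparable e x y : ends e = [set x; y] -> anc up x y \/ anc up y x;
  pos_inj : injective pos;
  pos_bound v : pos v < #|vertex G|
}.

Lemma dfs_tree_normal (G : mgraph) (r : vertex G) disc up :
  spanning_connected [set: edge G] -> dfs_tree r disc up ->
  [/\ uniq disc, forall v, v \in disc & normal_tree r (index^~ disc) up].
Proof.
move=> conG /dfs_runP I.
have all_disc v : v \in disc.
  (* The final stack is empty, so [dfs_finished] closes the set of discovered vertices under
     adjacency. *)
  suff clo : closed (adj [set: edge G]) (mem disc).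
    by rewrite -(closed_connect clo (conG r v)) (dfs_root I).
  have step x y : adj [set: edge G] x y -> x \in disc -> y \in disc.
    by case/existsP=> e /andP[_ /eqP xy] xd; apply: (dfs_finished I) xd _ xy.
  move=> x y xy; apply/idP/idP; first exact: step.
  apply: step; case/existsP: xy => e /andP[_ xy]; apply/existsP; exists e.
  by rewrite inE setUC.
split=> //; first exact: dfs_uniq I.
split.
- by move=> v e u /(dfs_some I)[].
- by move=> v e u /(dfs_some I)[].
- exact: dfs_uproot I.
- by move=> v; apply: (dfs_none I).
- by move=> e x y; apply: (dfs_comparable I).
- move=> x y /= E; rewrite -(nth_index x (all_disc x)) E nth_index //.
- move=> v; apply: leq_trans (max_card (mem disc)).
  by rewrite (card_uniqP (dfs_uniq I)) index_mem.
Qed.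

(** * Climbing in a normal tree *)

Section NormalTree.
Variables (G : mgraph) (r : vertex G) (pos : vertex G -> nat) (up : forest G).
Hypothesis nt : normal_tree r pos up.
Implicit Types (x y z v : vertex G) (vis : {set vertex G}).

Lemma anc_pos x y : anc up x y -> pos x <= pos y.
Proof.
elim=> // {}y e u upy _ le; exact: leq_trans le (ltnW (up_pos nt upy)).
Qed.

Lemma anc_anti x y : anc up x y -> anc up y x -> x = y.
Proof.
by move=> /anc_pos le /anc_pos ge; apply: (pos_inj nt); apply/eqP; rewrite eqn_leq le.
Qed.

Lemma anc_root x : anc up r x.
Proof.
have [n] := ubnP (pos x); elim: n x => // n IH x le.
case upx: (up x) => [[e u]|]; last by rewrite (up_none nt upx); apply: anc_refl.
apply: (anc_up upx); apply: IH; exact: leq_trans (up_pos nt upx) le.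
Qed.

Lemma anc_parent x y e u : anc up x y -> x <> y -> up y = Some (e, u) ->
  anc up x u.
Proof. by case/anc_inv=> [//|[e' [u' [-> xu]]]] _ [_ <-]. Qed.

Lemma parent_anc y e u : up y = Some (e, u) -> anc up u y.
Proof. by move=> upy; apply: anc_up upy (anc_refl _ _). Qed.

Lemma up_inj v w e u u' : up v = Some (e, u) -> up w = Some (e, u') -> v = w.
Proof.
move=> upv upw; have := up_ends nt upv; rewrite (up_ends nt upw).
case/set2_inj=> [[]//|[Ew Ev]]; have := up_pos nt upv; have := up_pos nt upw.
by rewrite -Ew Ev => lt1 /(ltn_trans lt1); rewrite ltnn.
Qed.

(** Positions drop with every step, so any fuel of at least [pos v] reaches the root. *)
Lemma climb_stable m n v : pos v <= m -> pos v <= n -> climb up m v = climb up n v.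
Proof.
elim: m n v => [|m IH] [|n] v //=; case upv: (up v) => [[e u]|//].
- by have := up_pos nt upv; case: (pos v).
- by have := up_pos nt upv; case: (pos v).
- move=> lem len; congr (_ :: _).
  by apply: IH; rewrite -ltnS; apply: leq_trans (up_pos nt upv) _.
Qed.

Lemma root_pathE v : root_path up v =
  if up v is Some (e, u) then (e, u) :: root_path up u else [::].
Proof.
rewrite {1}/root_path; have := pos_bound nt v.
case: #|_| (pos_bound nt) => // n bnd _ /=.
case upv: (up v) => [[e u]|//]; congr (_ :: _).
apply: climb_stable; last by rewrite ltnW // (pos_bound nt).
by rewrite -ltnS; apply: leq_trans (up_pos nt upv) _; apply: ltnW; apply: bnd.
Qed.

Lemma ancestorP x y : reflect (anc up x y) (ancestor up x y).
Proof.
rewrite /ancestor; have [n] := ubnP (pos y); elim: n y => // n IH y le.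
rewrite root_pathE inE; apply: (iffP predU1P).
  case=> [->|]; first exact: anc_refl.
  case upy: (up y) => [[e u]|//] xu; apply: (anc_up upy); apply/IH => //.
  exact: leq_trans (up_pos nt upy) le.
case/anc_inv=> [->|[e [u [upy xu]]]]; [by left | right].
by rewrite upy; apply/(IH u) => //; apply: leq_trans (up_pos nt upy) le.
Qed.

(** The tree part of [make_chain]; with the vertex set of the union in place of the visited set it
    also defines [top]. *)
Definition climb_to vis w :=
  take (find (mem vis) (w :: unzip2 (root_path up w))) (root_path up w).

Lemma climb_to_in vis w : w \in vis -> climb_to vis w = [::].
Proof. by rewrite /climb_to /= => ->; rewrite take0. Qed.

Lemma climb_to_notin vis w e u : w \notin vis -> up w = Some (e, u) ->
  climb_to vis w = (e, u) :: climb_to vis u.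
Proof. by rewrite /climb_to root_pathE /= => /negPf-> -> /=. Qed.

Record climb_spec vis v w q : Prop := ClimbSpec {
  cl_walk : walk_from w q;
  cl_vis : last w (unzip2 q) \in vis;
  cl_anc : anc up v (last w (unzip2 q));
  cl_inner x : x \in belast w (unzip2 q) -> x \notin vis /\
    exists e u, [/\ up x = Some (e, u), e \in unzip1 q & u \in unzip2 q];
  cl_edge f : f \in unzip1 q ->
    exists x u, x \in belast w (unzip2 q) /\ up x = Some (f, u);
  cl_pos x : x \in unzip2 q -> pos x < pos w;
  cl_uniqv : uniq (w :: unzip2 q);
  cl_uniqe : uniq (unzip1 q);
  cl_cover c : anc up c w ->
    c \in belast w (unzip2 q) \/ anc up c (last w (unzip2 q))
}.

(** As [v] is itself in [vis], the climb from its descendant [w] stops at [v] or below it, so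
    induction along the tree path from [v] to [w] suffices. Decreasing positions keep the vertices
    distinct, and [up_inj] the edges. *)
Lemma climb_toP vis v w : v \in vis -> anc up v w ->
  climb_spec vis v w (climb_to vis w).
Proof.
move=> vv; elim=> [|{}w e u upw vu IH].
  by rewrite climb_to_in //; split=> //= [|c]; [apply: anc_refl | right].
have [wv|wv] := boolP (w \in vis).
  by rewrite climb_to_in //; split=> //= [|c]; [apply: anc_up upw vu | right].
rewrite (climb_to_notin wv upw); move: (climb_to vis u) IH => q IH.
have posq x : x \in u :: unzip2 q -> pos x < pos w.
  rewrite inE => /predU1P[->|/(cl_pos IH) lt]; first exact: (up_pos nt upw).
  exact: ltn_trans lt (up_pos nt upw).
have belq x : x \in belast u (unzip2 q) -> x \in u :: unzip2 q by apply: mem_belast.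
split=> /=.
- by rewrite (up_ends nt upw) eqxx (cl_walk IH).
- exact: cl_vis IH.
- exact: cl_anc IH.
- move=> x; rewrite inE => /predU1P[->|/(cl_inner IH)[xv [e' [u' [upx e'q u'q]]]]].
    by split=> //; exists e, u; rewrite !inE !eqxx.
  by split=> //; exists e', u'; rewrite !inE e'q u'q !orbT.
- move=> f; rewrite inE => /predU1P[->|/(cl_edge IH)[x [u' [xq upx]]]].
    by exists w, u; rewrite inE eqxx.
  by exists x, u'; rewrite inE xq orbT.
- exact: posq.
- rewrite -/(uniq (u :: unzip2 q)) (cl_uniqv IH) andbT.
  by apply/negP=> /posq; rewrite ltnn.
- rewrite (cl_uniqe IH) andbT; apply/negP=> /(cl_edge IH)[x [u' [/belq/posq lt upx]]].
  by move: lt; rewrite (up_inj upx upw) ltnn.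
- move=> c cw; have [->|/eqP cNw] := eqVneq c w; first by left; rewrite inE eqxx.
  case: (cl_cover IH (anc_parent cw cNw upw)) => cq; last by right.
  by left; rewrite inE cq orbT.
Qed.

Lemma back_edgeP v e w : back_edge up v e w ->
  [/\ forall x u, up x <> Some (e, u), ends e = [set v; w], v <> w & anc up v w].
Proof.
case/and4P=> /existsPn nt' /eqP vw /eqP neq /ancestorP vaw; split=> // x u upx.
by have := nt' x; rewrite upx eqxx.
Qed.

Lemma back_edge_not_tree e x y : ends e = [set x; y] -> anc up x y ->
  (forall u, up y <> Some (e, u)) -> back_edge up x e y.
Proof.
move=> xy axy nup; apply/and4P; split; last 2 first.
- exact: ends_neq xy.
- exact/ancestorP.
- apply/existsPn=> v; apply/eqP; case upv: (up v) => [[f u]|//] /= [Ef].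
  rewrite Ef in upv; have := up_ends nt upv; rewrite xy.
  case/set2_inj=> -[Ex Ey]; last by apply: (nup u); rewrite Ey.
  by have := anc_pos axy; rewrite leqNgt Ex Ey (up_pos nt upv).
- exact/eqP.
Qed.

End NormalTree.

(** * Invariants of the chain decomposition *)

Section Chains.
Variables (G : mgraph) (r : vertex G) (pos : vertex G -> nat) (up : forest G).
Variable bk : vertex G -> seq (edge G * vertex G).
Hypothesis nt : normal_tree r pos up.
Hypothesis bkP : back_edge_lists up bk.

Definition job : Type := (vertex G * (edge G * vertex G))%type.
Implicit Types (d : seq (vertex G)) (J : seq job) (st : {set vertex G} * seq (walk G)).

(** Apart from the initial back-edge, the edges of a chain are the parent edges of its inner
    vertices. Edge-disjointness of chains thus reduces to a statement about visited vertices and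
    processed back-edges. *)
Record chain_spec J (C : walk G) : Prop := ChainSpec {
  ch_path : is_path C;
  ch_anc : anc up (wstart C) (wend C);
  ch_inner v : v \in winner C -> exists e u,
    [/\ up v = Some (e, u), e \in wedges C & u \in winner C \/ u = wend C];
  ch_edge f : f \in wedges C ->
    (exists v u, v \in winner C /\ up v = Some (f, u)) \/
    (exists w q, C = (wstart C, (f, w) :: q) /\ (wstart C, (f, w)) \in J)
}.

Lemma chain_spec_sub J J' C : {subset J <= J'} -> chain_spec J C -> chain_spec J' C.
Proof.
move=> sJ [p a i ed]; split=> // f /ed[?|[w [q [E /sJ inJ]]]]; first by left.
by right; exists w, q.
Qed.

(* [d] lists the vertices whose processing has started and [J] the back-edges
   already turned into chains. *)
Record chains_inv d J st : Prop := ChainsInv {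
  ci_job v e w : (v, (e, w)) \in J -> v \in d /\ back_edge up v e w;
  ci_vis v : v \in st.1 -> v \in d \/ exists2 C, C \in st.2 & v \in winner C;
  ci_disc v : v \in d -> v \in st.1;
  ci_winner C v : C \in st.2 -> v \in winner C -> v \in st.1;
  ci_parent v e u : v \in st.1 -> up v = Some (e, u) -> u \in st.1;
  ci_start C : C \in st.2 -> wstart C \in d;
  ci_chain C : C \in st.2 -> chain_spec J C;
  ci_disjoint C D f : C \in st.2 -> D \in st.2 ->
    f \in wedges C -> f \in wedges D -> C = D;
  ci_done x f y : (x, (f, y)) \in J -> exists q, (x, (f, y) :: q) \in st.2;
  ci_cover x f y c : (x, (f, y)) \in J -> anc up x c -> x <> c -> anc up c y ->
    exists C, [/\ C \in st.2, c \in winner C & pos (wstart C) <= pos x];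
  ci_first C0 cs : st.2 = C0 :: cs -> wend C0 = wstart C0 /\
    forall C, C \in st.2 -> pos (wstart C0) <= pos (wstart C)
}.

Lemma make_chainE vis v ew :
  make_chain up vis v ew = (v, ew :: climb_to up vis ew.2).
Proof. by []. Qed.

(** Inner vertices of the new chain were unvisited, while those of earlier chains are visited; this
    separates their tree edges. As vertices are processed in discovery order, no earlier chain
    starts after [v]. *)
Lemma process_back_edge_inv d J st v e w :
  chains_inv d J st -> v \in d -> {in d, forall u, pos u <= pos v} ->
  (e, w) \in bk v -> (v, (e, w)) \notin J ->
  chains_inv d (rcons J (v, (e, w))) (process_back_edge up v st (e, w)).
Proof.
case: st => vis cs I vd dv ebk jJ; rewrite /process_back_edge make_chainE /=.
have be : back_edge up v e w by rewrite -(bkP v).2.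
have [ntree vw vNw aw] := back_edgeP nt be.
have vvis : v \in vis := ci_disc I vd.
have cl := climb_toP nt vvis aw.
move: (climb_to up vis w) cl => q cl.
set C : walk G := (v, (e, w) :: q).
have weC : wend C = last w (unzip2 q) by [].
have wNvis x : x \in winner C -> x \notin vis by move/(cl_inner cl)=> [].
have subJ : {subset J <= rcons J (v, (e, w))}.
  by move=> j jJ'; rewrite mem_rcons inE jJ' orbT.
have specC : chain_spec (rcons J (v, (e, w))) C.
  split.
  - have eq : e \notin unzip1 q.
      by apply/negP=> /(cl_edge cl)[x [u [_ /ntree]]].
    have vq : v \notin belast w (unzip2 q).
      by apply/negP=> vq; have := wNvis v vq; rewrite vvis.
    have := cl_uniqv cl; rewrite lastI rcons_uniq => /andP[_ uq].
    rewrite /is_path /is_walk /= vw eqxx (cl_walk cl) eq vq uq (cl_uniqe cl) /=.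
    exact: cl_uniqv cl.
  - exact: cl_anc cl.
  - move=> x /(cl_inner cl)[_ [f [u [upx fq uq]]]]; exists f, u; split=> //.
      by rewrite inE fq orbT.
    have : u \in w :: unzip2 q by rewrite inE uq orbT.
    by rewrite lastI mem_rcons inE -weC => /predU1P[]; [right | left].
  - move=> f; rewrite inE => /predU1P[->|/(cl_edge cl)]; last by left.
    by right; exists w, q; rewrite mem_rcons inE eqxx.
have disj D f : D \in cs -> f \in wedges C -> f \in wedges D -> False.
  move=> Dcs fC fD.
  case: (ch_edge (ci_chain I Dcs) fD) => [[y [u' [yD upy]]]|[w' [q' [ED inJ]]]].
    case: (ch_edge specC fC) => [[x [u [xC upx]]]|[w' [q' [[Ef _ _] _]]]].
      by move: (wNvis x xC); rewrite (up_inj nt upx upy) (ci_winner I Dcs yD).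
    by apply: (ntree y u'); rewrite upy Ef.
  have [_ /(back_edgeP nt)[nt' sw' sNw' asw']] := ci_job I inJ.
  case: (ch_edge specC fC) => [[x [u [xC upx]]]|[w'' [q'' [[Ef _ _] _]]]].
    exact: nt' upx.
  (* If both chains began with the same back-edge, equal orientations would put the job into [J]
     already, and opposite ones contradict antisymmetry. *)
  move: sw' nt' inJ; rewrite -Ef vw => /set2_inj[[<- <-]|[Ew Ev]] _; first exact/negP.
  by case: vNw; apply: (anc_anti nt); rewrite // Ew Ev.
split=> /=.
- move=> x f y; rewrite mem_rcons inE => /predU1P[[-> -> ->]//|].
  by move/(ci_job I).
- move=> x; rewrite !inE => /orP[/(ci_vis I)[xd|[D Dcs xD]]|xC]; first by left.
    by right; exists D; rewrite // mem_rcons inE Dcs orbT.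
  by right; exists C; rewrite // mem_rcons inE eqxx.
- by move=> x /(ci_disc I) xv; rewrite inE xv.
- move=> D x; rewrite mem_rcons !inE => /predU1P[->|Dcs] xD.
    by rewrite xD orbT.
  by rewrite (ci_winner I Dcs xD).
- move=> x f u; rewrite !inE => /orP[xv|xC] upx; first by rewrite (ci_parent I xv upx).
  have [f' [u' []]] := ch_inner specC xC; rewrite upx => -[_ <-] _ [->|->].
    by rewrite orbT.
  by rewrite weC (cl_vis cl).
- by move=> D; rewrite mem_rcons inE => /predU1P[->//|]; apply: ci_start I D.
- move=> D; rewrite mem_rcons inE => /predU1P[->//|Dcs].
  exact: chain_spec_sub subJ (ci_chain I Dcs).
- move=> D D' f; rewrite !mem_rcons !inE => /predU1P[->|Dcs] /predU1P[->|D'cs] // fD fD'.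
  + by case: (disj D' f).
  + by case: (disj D f).
  + exact: (ci_disjoint I Dcs D'cs fD fD').
- move=> x f y; rewrite mem_rcons inE => /predU1P[[-> -> ->]|/(ci_done I)[q' Dcs]].
    by exists q; rewrite mem_rcons inE eqxx.
  by exists q'; rewrite mem_rcons inE Dcs orbT.
- move=> x f y c; rewrite mem_rcons inE => /predU1P[[-> _ ->]|inJ] xc xNc cy; last first.
    have [D [Dcs cD le]] := ci_cover I inJ xc xNc cy.
    by exists D; rewrite mem_rcons inE Dcs orbT.
  case: (cl_cover cl cy) => [cC|ct].
    by exists C; rewrite mem_rcons inE eqxx.
  (* [c] is an ancestor of the visited vertex where the climb stops, and visited vertices are closed
     under parents. *)
  have cvis : c \in vis.
    move: (cl_vis cl); rewrite -weC in ct *; elim: ct => // z g u upz _ IH zvis.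
    exact: IH (ci_parent I zvis upz).
  (* No started vertex comes after [v], but [c] lies strictly below [v]; so [c] was visited as an
     inner vertex of an earlier chain. *)
  case: (ci_vis I cvis) => [/dv cv|[D Dcs cD]].
    by case: xNc; apply: (pos_inj nt); apply/eqP; rewrite eqn_leq cv (anc_pos nt xc).
  by exists D; rewrite mem_rcons inE Dcs orbT; split=> //; apply: dv; apply: ci_start I D Dcs.
- case: cs I disj => [|D0 cs] I disj C0 cs' /= [<- _].
    split; last by move=> D; rewrite inE => /eqP->.
    (* Before the first chain only started vertices are visited. The end of this chain is one of
       them and lies at or below [v], hence equals [v]. *)
    case: (ci_vis I (cl_vis cl)) => [td|[D //]].
    by apply: (pos_inj nt); apply/eqP; rewrite eqn_leq (dv _ td) (anc_pos nt (cl_anc cl)).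
  have [E le] := ci_first I erefl; split=> // D.
  rewrite inE mem_rcons inE => /or3P[/eqP->//|/eqP->|Dcs]; last first.
    by apply: le; rewrite inE Dcs orbT.
  by apply: dv; apply: (ci_start I); rewrite inE eqxx.
Qed.

Lemma process_back_edges_inv d v l J st :
  chains_inv d J st -> v \in d -> {in d, forall u, pos u <= pos v} ->
  uniq l -> {subset l <= bk v} -> {in l, forall ew, (v, ew) \notin J} ->
  chains_inv d (J ++ [seq (v, ew) | ew <- l]) (foldl (process_back_edge up v) st l).
Proof.
move=> + vd dv; elim: l J st => [|[e w] l IH] J st I /=; first by rewrite cats0.
case/andP=> ewl ul sl lJ; rewrite -cat_rcons; apply: IH => //.
- apply: process_back_edge_inv => //; first by apply: sl; rewrite inE eqxx.
  by apply: lJ; rewrite inE eqxx.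
- by move=> ew ewin; apply: sl; rewrite inE ewin orbT.
- move=> ew ewin; rewrite mem_rcons inE negb_or lJ ?inE ?ewin ?orbT // andbT.
  by apply: contraNneq ewl => -[<-].
Qed.

(** That the parent of [v] has been started keeps the visited set closed under parents. *)
Lemma start_vertex_inv d J vis cs v :
  chains_inv d J (vis, cs) ->
  (forall e u, up v = Some (e, u) -> u \in d) ->
  chains_inv (rcons d v) J (v |: vis, cs).
Proof.
move=> I pv; split=> /=.
- by move=> x e w /(ci_job I)[xd be]; rewrite mem_rcons inE xd orbT.
- move=> x; rewrite mem_rcons !inE => /predU1P[->|/(ci_vis I)[->|]].
  + by rewrite eqxx; left.
  + by rewrite orbT; left.
  + by right.
- by move=> x; rewrite mem_rcons !inE => /predU1P[->|/(ci_disc I)->]; rewrite ?eqxx ?orbT.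
- by move=> C x Ccs /(ci_winner I Ccs) xv; rewrite !inE xv orbT.
- move=> x e u; rewrite !inE => /predU1P[->|xv] upx.
    by rewrite (ci_disc I (pv _ _ upx)) orbT.
  by rewrite (ci_parent I xv upx) orbT.
- by move=> C /(ci_start I) sd; rewrite mem_rcons inE sd orbT.
- exact: ci_chain I.
- exact: ci_disjoint I.
- exact: ci_done I.
- exact: ci_cover I.
- exact: ci_first I.
Qed.

(** Induction over the prefixes of [disc]: the prefix of length [n] holds the vertices of position
    less than [n], so the next vertex comes after all of them and after its parent. *)
Lemma process_vertices_inv disc : uniq disc -> (forall v, v \in disc) ->
  pos =1 index^~ disc ->
  exists2 J, forall v ew, ew \in bk v -> (v, ew) \in J &
    chains_inv disc J (foldl (process_vertex up bk) (set0, [::]) disc).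
Proof.
move=> ud alld posE.
pose jobs d := [seq (v, ew) | v <- d, ew <- bk v].
have jobsP d v ew : ((v, ew) \in jobs d) = (v \in d) && (ew \in bk v).
  apply/allpairsPdep/andP=> [[x [y [xd yb [-> ->]]]]|[vd eb]] //.
  by exists v, ew.
suff Inv n : n <= size disc -> chains_inv (take n disc) (jobs (take n disc))
    (foldl (process_vertex up bk) (set0, [::]) (take n disc)).
  exists (jobs disc) => [v ew ewb|]; first by rewrite jobsP alld.
  by have := Inv _ (leqnn _); rewrite take_size.
elim: n => [_|n IH ltn].
  rewrite take0; split=> //= v; by rewrite inE.
move/(_ (ltnW ltn)) in IH.
pose v := nth r disc n; have nv : pos v = n by rewrite posE index_uniq.
have inT u : (u \in take n disc) = (pos u < n).
  by rewrite posE in_take.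
have vNd : v \notin take n disc by rewrite inT nv ltnn.
rewrite (take_nth r) // foldl_rcons -/v /process_vertex.
have -> : jobs (rcons (take n disc) v) = jobs (take n disc) ++ [seq (v, ew) | ew <- bk v].
  by rewrite /jobs map_rcons flatten_rcons.
apply: process_back_edges_inv.
- case: (foldl _ _ _) IH => vis cs IH; apply: start_vertex_inv => // e u upv.
  by rewrite inT -nv; apply: up_pos nt _ _ _ upv.
- by rewrite mem_rcons inE eqxx.
- by move=> u; rewrite mem_rcons inE nv inT => /predU1P[->|/ltnW//]; rewrite nv.
- exact: (bkP v).1.
- by [].
- by move=> ew _; rewrite jobsP (negPf vNd).
Qed.

End Chains.

(** * Links and vertices of degree two *)

Section Links.
Variables (G : mgraph) (F : {set edge G}).
Implicit Types (x y z u v : vertex G) (e f g : edge G) (L : walk G).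
Implicit Types (p q : seq (edge G * vertex G)).

Lemma ends_other e x : x \in ends e -> exists y, ends e = [set x; y].
Proof.
have /eqP/cards2P[u [v [_ ->]]] := card_ends e.
by rewrite !inE => /orP[]/eqP->; [exists v | exists u; rewrite setUC].
Qed.

Lemma adj_sym : symmetric (adj F).
Proof. by move=> x y; apply: eq_existsb => e; rewrite setUC. Qed.

Lemma vertsP x : reflect (exists2 e, e \in F & x \in ends e) (x \in verts F).
Proof. exact: bigcupP. Qed.

Lemma deg2_edge x f g h : deg F x = 2 -> f \in F -> g \in F -> h \in F ->
  x \in ends f -> x \in ends g -> x \in ends h -> f != g -> (h == f) || (h == g).
Proof.
move=> dx fF gF hF xf xg xh fg.
have /eqP E : [set f; g] == [set e in F | x \in ends e].
  rewrite eqEcard cards2 fg -/(deg F x) dx andbT; apply/subsetP=> e.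
  by rewrite !inE => /orP[]/eqP->; rewrite ?fF ?gF.
suff: h \in [set f; g] by rewrite !inE.
by rewrite E inE hF.
Qed.

Lemma deg2_other_edge x f : deg F x = 2 ->
  exists g, [/\ g \in F, x \in ends g & g != f].
Proof.
rewrite /deg => dx.
have : 0 < #|[set e in F | x \in ends e] :\ f|.
  by have := cardsD1 f [set e in F | x \in ends e]; rewrite dx lt0n; case: eqP => // ->; case: (_ \in _).
by case/card_gt0P=> g; rewrite !inE => /and3P[gf gF xg]; exists g.
Qed.

Lemma deg2_verts x : deg F x = 2 -> x \in verts F.
Proof.
move=> dx; have /card_gt0P[e] : 0 < #|[set e in F | x \in ends e]| by rewrite -/(deg F x) dx.
by rewrite inE => /andP[eF xe]; apply/vertsP; exists e.
Qed.

(** Connectivity under this relation stands in for lying inside a common link, so that no link has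
    to be built between given vertices. *)
Definition deg2_adj : rel (vertex G) :=
  fun u v => [&& deg F u == 2, deg F v == 2 & adj F u v].

Lemma deg2_adj_sym : symmetric deg2_adj.
Proof. by move=> x y; rewrite /deg2_adj adj_sym andbCA. Qed.

Lemma deg2_connect_sym x y : connect deg2_adj x y = connect deg2_adj y x.
Proof. exact: (sym_connect_sym deg2_adj_sym). Qed.

Lemma winner_split L x : reflect
  (exists p1 f g z p2, L.2 = p1 ++ (f, x) :: (g, z) :: p2) (x \in winner L).
Proof.
case: L => v p; rewrite /winner /=; apply: (iffP idP); last first.
  case=> p1 [f [g [z [p2 ->]]]]; rewrite /unzip2 map_cat belast_cat /=.
  by case: p1 => [|[e w] p1] /=; rewrite ?mem_cat !inE eqxx ?orbT.
case: p => [|[e w] q] //=; elim: q e w => [|[g z] q IH] e w //=.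
rewrite inE => /predU1P[->|/(IH g)[p1 [f [g' [z' [p2 ->]]]]]].
  by exists [::], e, g, z, q.
by exists ((e, w) :: p1), f, g', z', p2.
Qed.

Lemma walk_from_cat v p q : walk_from v (p ++ q) =
  walk_from v p && walk_from (last v (unzip2 p)) q.
Proof. by elim: p v => [|[e w] p IH] v //=; rewrite IH andbA. Qed.

Lemma walk_edge_ends v p f : walk_from v p -> f \in unzip1 p ->
  {subset ends f <= v :: unzip2 p}.
Proof.
elim: p v => [|[e w] p IH] v //= /andP[/eqP vw wp].
rewrite inE => /predU1P[->|fp] x.
  by rewrite vw !inE => /orP[]->; rewrite ?orbT.
by move/(IH w wp fp); rewrite !inE => ->; rewrite orbT.
Qed.

Lemma walk_inner_connect w q : walk_from w q -> {subset unzip1 q <= F} ->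
  {in belast w (unzip2 q), forall v, deg F v = 2} ->
  {in belast w (unzip2 q), forall v, connect deg2_adj w v}.
Proof.
elim: q w => [|[g z] q IH] w //= /andP[gwz wq] qF dq x.
rewrite inE => /predU1P[->|xq]; first exact: connect0.
have zq : z \in belast z (unzip2 q) by case: (q) xq => [|[]] //= *; rewrite inE eqxx.
apply: (@connect_trans _ _ z).
  apply: connect1; rewrite /deg2_adj !dq ?inE ?zq ?eqxx ?orbT //=.
  by apply/existsP; exists g; rewrite gwz qF // inE eqxx.
apply: IH xq => // [e eq|v vq]; first by apply: qF; rewrite inE eq orbT.
by apply: dq; rewrite inE vq orbT.
Qed.

Lemma winner_connect L : link_like F L ->
  {in winner L &, forall x y, connect deg2_adj x y}.
Proof.
case: L => v [|[e w] q] [/and5P[+ _ _ _ _] qF dq] x y xq yq //.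
rewrite /is_walk /= => /andP[_ wq].
have toL : {in belast w (unzip2 q), forall v, connect deg2_adj w v}.
  by apply: walk_inner_connect => // f fq; apply: qF; rewrite inE fq orbT.
by apply: (@connect_trans _ _ w); [rewrite deg2_connect_sym|]; apply: toL.
Qed.

(** The path edges before and after [x] are distinct and exhaust its degree, so [f] is one of
    them. *)
Lemma winner_edge L x y f : link_like F L -> x \in winner L -> f \in F ->
  ends f = [set x; y] -> exists p1 g z h p2,
  [/\ L.2 = p1 ++ (g, x) :: (h, z) :: p2, ends g = [set last L.1 (unzip2 p1); x],
      ends h = [set x; z] & (f = g /\ y = last L.1 (unzip2 p1)) \/ (f = h /\ y = z)].
Proof.
case: L => v p [/and5P[wL _ uL _ _] LF dL] xL fF xy.
have [p1 [g [h [z [p2 Ep]]]]] := winner_split _ _ xL.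
move: wL; rewrite /is_walk [p]Ep walk_from_cat /= => /and4P[_ /eqP gE /eqP hE _].
move: uL; rewrite /wedges [p]Ep /unzip1 map_cat cat_uniq.
case/and3P=> _ _ /andP[]; rewrite inE negb_or => /andP[gh _] _.
have inL e : e \in [:: g; h] -> e \in F.
  move=> eg; apply: LF; rewrite /wedges [p]Ep /unzip1 map_cat mem_cat /= !inE.
  by move: eg; rewrite !inE => /orP[]->; rewrite !orbT.
exists p1, g, z, h, p2; split=> //.
have gF : g \in F by apply: inL; rewrite inE eqxx.
have hF : h \in F by apply: inL; rewrite !inE eqxx orbT.
have xg : x \in ends g by rewrite gE set22.
have xh : x \in ends h by rewrite hE set21.
have xf : x \in ends f by rewrite xy set21.
case/orP: (deg2_edge (dL _ xL) gF hF fF xg xh xf gh) => /eqP E; [left|right].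
  by split=> //; move: gE; rewrite -E xy setUC => /set2_inj[[]|[-> ->]].
by split=> //; move: hE; rewrite -E xy => /set2_inj[[]|[-> ->]].
Qed.

Lemma winner_edge_in L x y f : link_like F L -> x \in winner L -> f \in F ->
  ends f = [set x; y] -> f \in wedges L /\ y \in L.1 :: unzip2 L.2.
Proof.
move=> ll xL fF xy; have [p1 [g [z [h [p2 [Ep _ _ H]]]]]] := winner_edge ll xL fF xy.
rewrite /wedges Ep /unzip1 /unzip2 !map_cat -cat_cons !mem_cat /= !inE.
case: H => -[-> ->]; rewrite !eqxx !orbT; split=> //.
by have := mem_last L.1 (unzip2 p1); rewrite inE => ->.
Qed.

(** By [winner_edge], [f] is the path edge just before or after [x]. Its other end fails to be inner
    only where the path begins or stops, and there [f] is [e1] or [e2]. *)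
Lemma winner_edge_winner L e1 e2 es x y f : link_like F L ->
  wedges L = e1 :: rcons es e2 -> x \in winner L -> f \in F ->
  ends f = [set x; y] -> f != e1 -> f != e2 -> y \in winner L.
Proof.
move=> ll EL xL fF xy fe1 fe2.
have [p1 [g [z [h [p2 [Ep _ _ [[Ef Ey]|[Ef Ey]]]]]]]] := winner_edge ll xL fF xy.
  case/lastP: p1 Ep Ey => [|p1 [k y']] Ep.
    by move: EL; rewrite /wedges Ep => -[Eg]; rewrite Ef Eg eqxx in fe1.
  rewrite /unzip2 map_rcons last_rcons => ->; apply/winner_split.
  by exists p1, k, g, x, ((h, z) :: p2); rewrite Ep cat_rcons.
case: p2 Ep => [|[k z'] p2] Ep.
  have : last e1 (wedges L) = e2 by rewrite EL /= last_rcons.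
  rewrite /wedges Ep /unzip1 map_cat last_cat /= => Eh.
  by rewrite Ef Eh eqxx in fe2.
apply/winner_split; rewrite Ey.
by exists (rcons p1 (g, x)), h, k, z', p2; rewrite Ep cat_rcons.
Qed.

End Links.

(** * Consequences of the maximality of links *)

Section LinkEnds.
Variables (G : mgraph) (F : {set edge G}) (r : vertex G).
Hypothesis conF : {in verts F, forall v, connect (adj F) v r}.
Hypothesis degr : deg F r <> 2.

Lemma path_vertices (P : walk G) : P.2 <> [::] ->
  P.1 :: unzip2 P.2 = wstart P :: rcons (winner P) (wend P).
Proof. by case: P => v [|[e w] q] //= _; rewrite /winner /wend /= -lastI. Qed.

(* If the closed path [L] had only vertices of degree two, it would be a whole
   component of [F], which would not contain [r]. *)
Lemma closed_link_deg (L : walk G) e1 e2 es : link_like F L ->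
  wedges L = e1 :: rcons es e2 -> wstart L = wend L -> deg F (wstart L) <> 2.
Proof.
move=> ll EL closedL d0; have [pL LF dL] := ll.
case/and5P: (pL) => wL nL uL _ _.
have vsE := path_vertices (elimN eqP nL).
have d2 x : x \in L.1 :: unzip2 L.2 -> deg F x = 2.
  rewrite vsE inE mem_rcons inE -closedL orbA orbb => /predU1P[->//|].
  exact: dL.
have [eL e2L] : e1 \in wedges L /\ e2 \in wedges L.
  by rewrite EL; split; rewrite inE ?mem_rcons ?inE eqxx ?orbT.
have e12 : e1 != e2.
  by move: uL; rewrite EL /= mem_rcons inE negb_or => /andP[/andP[]].
have [e1s e2s] : wstart L \in ends e1 /\ wstart L \in ends e2.
  split; last rewrite closedL; case: (L) EL wL => v p /=.
    case: p => [|[e w] q] // [-> _]; rewrite /is_walk /= => /andP[/eqP-> _].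
    by rewrite set21.
  case/lastP: p => [|q [e w]] //; rewrite /wedges /unzip1 map_rcons /= -rcons_cons.
  case/rcons_inj=> _ ->; rewrite /is_walk /= -cats1 walk_from_cat /= andbT.
  case/andP=> _ /eqP->; rewrite /wend /= /unzip2 map_cat last_cat /=.
  by rewrite set22.
have clo : closed (adj F) [in L.1 :: unzip2 L.2].
  have step x y : adj F x y -> x \in L.1 :: unzip2 L.2 -> y \in L.1 :: unzip2 L.2.
    case/existsP=> f /andP[fF /eqP xy].
    rewrite {1}vsE inE mem_rcons inE -closedL orbA orbb => /predU1P[Ex|xL]; last first.
      by case: (winner_edge_in ll xL fF xy).
    have xf : wstart L \in ends f by rewrite xy -Ex set21.
    have yf : y \in ends f by rewrite xy set22.
    suff fL : f \in wedges L by apply: walk_edge_ends wL fL _ yf.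
    by case/orP: (deg2_edge d0 (LF _ eL) (LF _ e2L) fF e1s e2s xf e12) => /eqP->.
  move=> x y xy; apply/idP/idP; apply: step => //; by rewrite adj_sym.
have v0 : wstart L \in verts F by apply: deg2_verts.
apply/degr/d2; have := closed_connect clo (conF v0); rewrite -topredE /= inE eqxx.
by move <-.
Qed.

(** At an end of degree two, an open link could be prolonged by the second edge of [F] there,
    against maximality; closed links are covered by [closed_link_deg]. *)
Lemma link_end_deg (L : walk G) e1 e2 es : link F L ->
  wedges L = e1 :: rcons es e2 -> deg F (wstart L) <> 2 /\ deg F (wend L) <> 2.
Proof.
move=> [ll maxL] EL; have [pL LF dL] := ll.
have [cl|/eqP opn] := eqVneq (wstart L) (wend L).
  by rewrite -cl; split; apply: closed_link_deg ll EL cl.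
case/and5P: (pL) => wL nL uL ub uv.
have vsE := path_vertices (elimN eqP nL).
have belE : belast L.1 (unzip2 L.2) = wstart L :: winner L.
  by case: (L) nL => v [|[e w] q].
have unzE : unzip2 L.2 = rcons (winner L) (wend L) by case: vsE.
have uall : uniq (L.1 :: unzip2 L.2).
  rewrite /= uv andbT unzE mem_rcons inE negb_or; apply/andP; split; first exact/eqP.
  by move: ub; rewrite belE => /andP[].
have notinner g x z : g \in F -> ends g = [set z; x] -> g \notin wedges L ->
    z \notin winner L.
  move=> gF zx; apply: contra => zL; by case: (winner_edge_in ll zL gF zx).
split=> [d0|dt].
- have [g [gF vg ge1]] := deg2_other_edge e1 d0.
  have [z] := ends_other vg; rewrite setUC => zv.
  have gL : g \notin wedges L.
    case: (L) EL wL uall vg => v p; case: p => [|[e w] q] // [-> _].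
    rewrite /is_walk /= => /andP[_ wq] /andP[vq _] vg.
    rewrite /wedges /= inE negb_or ge1; apply: contra vq => gq.
    exact: walk_edge_ends wq gq _ vg.
  (* The new start [z] is not inner in [L], but it may be the far end of [L]; then [Q] is a closed
     path, which [is_path] admits. *)
  pose Q : walk G := (z, (g, L.1) :: L.2).
  have llQ : link_like F Q.
    split.
    + rewrite /is_path /is_walk /= zv eqxx [walk_from _ _]wL [_ \notin _]gL [uniq (unzip1 _)]uL ub uv /=.
      move: uall; rewrite /= uv andbT => -> /=; rewrite belE inE negb_or.
      by rewrite (ends_neq zv) (notinner g L.1 z) // andbT.
    + by move=> f; rewrite inE => /predU1P[->|/LF].
    + by move=> x; rewrite /winner /= belE inE => /predU1P[->|/dL].
  have sub : {subset wedges Q <= wedges L}.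
    by apply: maxL => // f fL; rewrite inE fL orbT.
  by move: gL; rewrite sub // inE eqxx.
- have [g [gF vg ge1]] := deg2_other_edge e2 dt.
  have [z vz] := ends_other vg; have zv := vz; rewrite setUC in zv.
  have gL : g \notin wedges L.
    case: (L) EL wL uall vg => v p; case/lastP: p => [|q [e w]] //.
    rewrite /wedges /wend /is_walk /unzip1 /unzip2 !map_rcons last_rcons /= -rcons_cons.
    case/rcons_inj=> _ ->; rewrite -cats1 walk_from_cat => /andP[wq _].
    rewrite -/(uniq (v :: rcons _ _)) -rcons_cons rcons_uniq => /andP[vq _] vg.
    rewrite mem_rcons inE negb_or ge1; apply: contra vq => gq.
    exact: walk_edge_ends wq gq _ vg.
  pose Q : walk G := (L.1, rcons L.2 (g, z)).
  have llQ : link_like F Q.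
    rewrite /Q; split.
    + rewrite /is_path /is_walk /wedges /unzip1 /unzip2 !map_rcons /= belast_rcons.
      rewrite -!cats1 walk_from_cat [walk_from _ _]wL /= vz eqxx /=.
      rewrite !cats1 !rcons_uniq gL uL -/(unzip2 L.2) uv /=.
      case/andP: uall => -> _; rewrite unzE mem_rcons inE negb_or.
      rewrite (ends_neq zv) (notinner g (wend L) z) // -size_eq0.
      by rewrite size_rcons.
    + by move=> f; rewrite /wedges /unzip1 map_rcons mem_rcons inE => /predU1P[->|/LF].
    + move=> x; rewrite /winner /unzip2 map_rcons /= belast_rcons /= -/(unzip2 L.2).
      by rewrite unzE mem_rcons inE => /predU1P[->|/dL].
  have sub : {subset wedges Q <= wedges L}.
    by apply: maxL => // f fL; rewrite /wedges /unzip1 map_rcons mem_rcons inE fL orbT.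
  by move: gL; rewrite sub // /wedges /unzip1 map_rcons mem_rcons inE eqxx.
Qed.

(** A neighbour in [F] of an inner vertex lies on the link, and if it has degree two it is not an
    end, by [link_end_deg]. *)
Lemma winner_closed (L : walk G) e1 e2 es : link F L ->
  wedges L = e1 :: rcons es e2 -> closed (deg2_adj F) [in winner L].
Proof.
move=> lL EL; have [d0 dt] := link_end_deg lL EL; have [ll _] := lL.
have [pL LF dL] := ll; case/and5P: (pL) => wL nL uL ub uv.
have vsE := path_vertices (elimN eqP nL).
have step x y : deg2_adj F x y -> x \in winner L -> y \in winner L.
  case/and3P=> _ /eqP dy /existsP[f /andP[fF /eqP xy]] xL.
  have [_] := winner_edge_in ll xL fF xy; rewrite vsE inE mem_rcons inE.
  by case/or3P=> // /eqP Ey; rewrite Ey in dy.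
move=> x y xy; apply/idP/idP; apply: step => //; by rewrite deg2_adj_sym.
Qed.

End LinkEnds.

(** * Parent-closed unions of chains as subtrees *)

Section ParentClosed.
Variables (G : mgraph) (r : vertex G) (pos : vertex G -> nat) (up : forest G).
Variables (disc : seq (vertex G)) (J : seq (job G)) (vis : {set vertex G}).
Variables (C1 : walk G) (cs Gc : seq (walk G)).
Hypothesis nt : normal_tree r pos up.
Hypothesis I : chains_inv pos up disc J (vis, cs).
Hypothesis Jall : forall v e w, back_edge up v e w -> (v, (e, w)) \in J.
Hypothesis GcS : {subset Gc <= cs}.
Hypothesis GcC1 : C1 \in Gc.
Hypothesis C1r : wend C1 = r.
Hypothesis Gcpc : parent_closed up r C1 cs Gc.
Hypothesis noMader : forall C : walk G, child_chain up r C1 cs Gc C ->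
  ~ mader_path (union_of Gc) C.

Notation F := (union_of Gc).
Hypothesis r_verts : r \in verts F.
Hypothesis degr : deg F r <> 2.

(* This is the vertex set of [F], in a form that is easy to climb from. *)
Definition tree_closure : {set vertex G} :=
  [set v | if up v is Some (e, _) then e \in F else true].
Notation W := tree_closure.
Implicit Types (C D : walk G) (x y z v : vertex G).

Lemma unionP e : reflect (exists2 C, C \in Gc & e \in wedges C) (e \in F).
Proof. by rewrite inE; apply: hasP. Qed.

Lemma union_disjoint C e : C \in cs -> C \notin Gc -> e \in wedges C -> e \notin F.
Proof.
move=> Ccs CGc eC; apply: contra CGc => /unionP[D DGc eD].
by rewrite (ci_disjoint I Ccs (GcS DGc) eC eD).
Qed.

Lemma root_W : r \in W.
Proof. by rewrite inE (up_root nt). Qed.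

Lemma up_W v e u : up v = Some (e, u) -> (v \in W) = (e \in F).
Proof. by rewrite inE => ->. Qed.

Lemma winner_W C v : C \in Gc -> v \in winner C -> v \in W.
Proof.
move=> CGc /(ch_inner (ci_chain I (GcS CGc)))[e [u [upv eC _]]].
by rewrite (up_W upv); apply/unionP; exists C.
Qed.

Lemma winner_notW C v : C \in cs -> C \notin Gc -> v \in winner C -> v \notin W.
Proof.
move=> Ccs CGc /(ch_inner (ci_chain I Ccs))[e [u [upv eC _]]].
by rewrite (up_W upv); apply: union_disjoint eC.
Qed.

(** Parent-closedness enters here: unless the end is the root, its parent edge lies in the parent
    chain, which belongs to [Gc]. *)
Lemma wend_W C : C \in Gc -> wend C \in W.
Proof.
move=> CGc; have [->|/eqP CC1] := eqVneq C C1; first by rewrite C1r root_W.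
have [D DGc [_ _]] := Gcpc CGc CC1; rewrite /s_belongs.
case: eqP => [->|_ [e [u [upt eD]]]]; first by rewrite root_W.
by rewrite (up_W upt); apply/unionP; exists D.
Qed.

(** The tree edge [e] is not the back-edge of the chain of [Gc] containing it, so [v] is inner in
    that chain and [u] is its next vertex, inner or final. *)
Lemma parent_W v e u : v \in W -> up v = Some (e, u) -> u \in W.
Proof.
move=> vW upv; move: vW; rewrite (up_W upv) => /unionP[C CGc eC].
have spC := ci_chain I (GcS CGc).
case: (ch_edge spC eC) => [[v' [u' [v'C upv']]]|[w [q [_ inJ]]]]; last first.
  by have [_ /(back_edgeP nt)[nt' _ _ _]] := ci_job I inJ; case: (nt' v u).
rewrite -(up_inj nt upv upv') in v'C.
have [e'' [u'' []]] := ch_inner spC v'C; rewrite upv => -[_ <-] _ [uC|->].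
  exact: winner_W uC.
exact: wend_W.
Qed.

Lemma anc_W x y : anc up x y -> y \in W -> x \in W.
Proof. by elim=> // {}y e u upy _ IH yW; apply: IH; apply: parent_W yW upy. Qed.

Lemma wstart_W C : C \in Gc -> wstart C \in W.
Proof.
by move=> CGc; apply: anc_W (wend_W CGc); apply: ch_anc (ci_chain I (GcS CGc)).
Qed.

Lemma verts_W x : x \in verts F -> x \in W.
Proof.
case/vertsP=> e /unionP[C CGc eC] xe.
case/and5P: (ch_path (ci_chain I (GcS CGc))) => wC /eqP nC _ _ _.
have := walk_edge_ends wC eC xe; rewrite (path_vertices nC) inE mem_rcons inE.
case/or3P=> [/eqP->|/eqP->|]; [exact: wstart_W | exact: wend_W | exact: winner_W].
Qed.

Lemma W_verts x : x \in W -> x \in verts F.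
Proof.
case upx: (up x) => [[e u]|]; last by rewrite (up_none nt upx).
by rewrite (up_W upx) => eF; apply/vertsP; exists e; rewrite // (up_ends nt upx) set21.
Qed.

Lemma union_connect : {in verts F, forall v, connect (adj F) v r}.
Proof.
move=> v /verts_W; have := anc_root nt v; elim=> // {}v e u upv _ IH vW.
apply: connect_trans (IH (parent_W vW upv)); apply: connect1.
by apply/existsP; exists e; rewrite -(up_W upv) vW (up_ends nt upv) /=.
Qed.

(** Such a chain has its parent in [Gc] and is an ear of [F]: its inner vertices avoid [W] and its
    edges avoid [F]. Not being a Mader-path, it has both ends inside one link. *)
Lemma child_chain_connect C : C \in cs -> C \notin Gc -> wend C \in W ->
  connect (deg2_adj F) (wstart C) (wend C) /\ deg F (wend C) = 2 /\ deg F (wstart C) = 2.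
Proof.
move=> Ccs CGc tW; have spC := ci_chain I Ccs.
have chC : child_chain up r C1 cs Gc C.
  split=> //; have CC1 : C <> C1 by move=> E; rewrite E GcC1 in CGc.
  have [tr|/eqP tr] := eqVneq (wend C) r.
    by exists C1 => //; split=> //; [apply: GcS | rewrite /s_belongs tr eqxx].
  case upt: (up (wend C)) => [[e u]|]; last by case: tr; apply: (up_none nt).
  have /unionP[D DGc eD] : e \in F by rewrite -(up_W upt).
  exists D => //; split=> //; first exact: GcS.
  by rewrite /s_belongs; case: eqP => // _; exists e, u.
have earC : ear F C.
  split.
  - exact: ch_path spC.
  - by split; apply: W_verts => //; apply: anc_W tW; apply: ch_anc spC.
  - by move=> v vC; apply: contra (winner_notW Ccs CGc vC); apply: verts_W.
  - by move=> e; apply: union_disjoint.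
(* The common link is only known not to be absent; a boolean goal allows the argument by
   contradiction. *)
suff : [&& connect (deg2_adj F) (wstart C) (wend C), deg F (wend C) == 2 &
          deg F (wstart C) == 2].
  by case/and3P=> -> /eqP-> /eqP->.
apply/negPn/negP => Ncon; apply: (noMader chC); split=> // -[L [ll _] [sL tL]].
have [_ _ dL] := ll.
by move: Ncon; rewrite (winner_connect ll sL tL) !dL.
Qed.

(* Otherwise some edge between vertices of degree two bypasses [z] along the
   tree, and its upper end also has a parent edge and a child edge in [F]. *)
Lemma tree_path_deg2 s a z : connect (deg2_adj F) s a -> deg F s = 2 ->
  deg F a = 2 -> anc up s z -> anc up z a -> deg F z = 2.
Proof.
move=> con ds da sz za; apply/eqP; apply/negPn/negP => dz.
have aW : a \in W by apply/verts_W/deg2_verts.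
(* This set contains [a] but not [s], so it cannot be closed under [deg2_adj F]. *)
pose below y := ancestor up z y && (y != z).
have belowP y : reflect (anc up z y /\ y <> z) (below y).
  by apply: (iffP andP) => -[zy /eqP yz]; split=> //; apply/(ancestorP nt).
have clo : closed (deg2_adj F) below.
  have step x y : deg2_adj F x y -> below x -> below y.
    case/and3P=> /eqP dx /eqP dy /existsP[e /andP[eF /eqP xy]] /belowP[zx xz].
    have yz : y <> z by move=> E; rewrite -E dy in dz.
    apply/belowP; split=> //.
    case: (edge_comparable nt xy) => [/(anc_trans zx)//|yx].
    case: (anc_total zx yx) => // yz'; exfalso.
    have [c [f [upc cz]]] := anc_child yz' yz.
    have fF : f \in F by rewrite -(up_W upc); apply: anc_W (anc_trans cz za) aW.
    (* [y] has degree two, hence is not the root and has a parent edge. The edges [f] and [g] then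
       leave no room for [e]. *)
    case upy: (up y) => [[g u]|]; last by apply: degr; rewrite -(up_none nt upy).
    have gF : g \in F by rewrite -(up_W upy); apply/verts_W/deg2_verts.
    have yf : y \in ends f by rewrite (up_ends nt upc) set22.
    have yg : y \in ends g by rewrite (up_ends nt upy) set21.
    have ye : y \in ends e by rewrite xy set22.
    have fg : f != g.
      apply/eqP=> Efg; rewrite Efg in upc.
      by have := up_pos nt upc; rewrite (up_inj nt upc upy) ltnn.
    case/orP: (deg2_edge dy fF gF eF yf yg ye fg) => /eqP E.
      move: xy; rewrite E (up_ends nt upc) => /set2_inj[[Ec _]|[Ec Ey]].
        by apply: xz; apply: (anc_anti nt) zx; rewrite -Ec.
      by have := up_pos nt upc; rewrite Ec ltnn.
    move: xy; rewrite E (up_ends nt upy) => /set2_inj[[Ey _]|[_ Eu]].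
      by have := anc_anti nt zx; rewrite -Ey => H; apply: yz; rewrite -H.
    by have := anc_pos nt yx; rewrite leqNgt -Eu (up_pos nt upy).
  move=> x y xy; apply/idP/idP; apply: step => //; by rewrite deg2_adj_sym.
have := closed_connect clo con.
have -> : s \in below = false.
  by apply/negP=> /belowP[zs]; case; apply: (anc_anti nt).
move/esym/negP; apply; apply/belowP; split=> // E.
by rewrite -E da in dz.
Qed.

(** By [tree_path_deg2] the tree path from [x] to [a] has only vertices of degree two, and its edges
    lie in [F] because [a] is in [W]. *)
Lemma tree_path_connect s a x : connect (deg2_adj F) s a -> deg F s = 2 ->
  deg F a = 2 -> anc up s x -> anc up x a -> connect (deg2_adj F) x a.
Proof.
move=> con ds da sx xa.
have d2 z : anc up x z -> anc up z a -> deg F z = 2.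
  by move=> xz; apply: tree_path_deg2 con ds da (anc_trans sx xz).
have aW : a \in W by apply/verts_W/deg2_verts.
elim: xa aW {con da} d2 => // b e u upb xu IH bW d2.
have ub := parent_anc upb.
apply: connect_trans (IH (parent_W bW upb) _) _.
  by move=> z xz zu; apply: d2 => //; apply: anc_trans zu ub.
have db : deg F b = 2 by apply: d2 (anc_refl _ _); apply: anc_up upb xu.
apply: connect1; rewrite /deg2_adj (d2 u xu ub) db /=.
by apply/existsP; exists e; rewrite -(up_W upb) bW (up_ends nt upb) setUC /=.
Qed.

(* The nearest ancestor of [y] in [W]. *)
Definition top y := last y (unzip2 (climb_to up W y)).

Lemma top_in y : y \in W -> top y = y.
Proof. by move=> yW; rewrite /top climb_to_in. Qed.

Lemma top_notin y e u : y \notin W -> up y = Some (e, u) -> top y = top u.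
Proof. by move=> yW upy; rewrite /top (climb_to_notin nt yW upy). Qed.

(** [W] is closed under ancestors, so the climb from [y] meets no vertex of [W] before passing
    [x]. *)
Lemma top_anc x y : anc up x y -> x \notin W -> top y = top x.
Proof.
elim=> // {}y e u upy xu IH xW; rewrite (top_notin _ upy) ?IH //.
by apply: contra xW; apply: anc_W; apply: anc_up upy xu.
Qed.

Lemma top_child y : y \notin W ->
  exists c e, [/\ c \notin W, up c = Some (e, top y), anc up c y & top y \in W].
Proof.
have := anc_root nt y; elim=> [|{}y e u upy _ IH yW]; first by rewrite root_W.
rewrite (top_notin yW upy); have [uW|uW] := boolP (u \in W).
  by exists y, e; rewrite top_in //; split=> //; apply: anc_refl.
have [c [f [cW upc cu tW]]] := IH uW.
by exists c, f; split=> //; apply: anc_up upy cu.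
Qed.

(** * The edges leaving the preimage of a link interior under [top] *)

Section Cut.
Variables (S : {pred vertex G}) (e1 e2 : edge G).
Hypothesis S_closed : closed (deg2_adj F) S.
Hypothesis S_edge : forall f x y, f \in F -> f != e1 -> f != e2 ->
  ends f = [set x; y] -> (x \in S) = (y \in S).

(** Edges of [F] are covered by [S_edge], and a tree edge outside [F] has the same [top] at both
    ends, as has a back-edge with [x] outside [W]. For a back-edge outside [F] with [x] in [W], the
    two tops are connected in [deg2_adj F]. *)
Lemma top_edge_anc f x y : ends f = [set x; y] -> anc up x y ->
  f != e1 -> f != e2 -> (top x \in S) = (top y \in S).
Proof.
move=> xy axy fe1 fe2.
have [fF|fF] := boolP (f \in F).
  have [xV yV] : x \in W /\ y \in W.
    by split; apply: verts_W; apply/vertsP; exists f; rewrite // xy ?set21 ?set22.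
  by rewrite !top_in //; apply: S_edge xy.
have [/eqP upy|nupy] := boolP (omap fst (up y) == Some f).
  case upy': (up y) upy => [[g u]|] //= [Eg]; rewrite Eg in upy'.
  have yW : y \notin W by rewrite (up_W upy').
  rewrite (top_notin yW upy'); move: xy; rewrite (up_ends nt upy').
  by case/set2_inj=> [[Ey Eu]|[_ ->]] //; rewrite -Ey Eu.
have be : back_edge up x f y.
  apply: (back_edge_not_tree nt) => // u upy; by rewrite upy eqxx in nupy.
have inJ := Jall be; have [q Ccs] := ci_done I inJ.
set C := (x, _ :: q) in Ccs.
have CGc : C \notin Gc.
  by apply: contra fF => CGc; apply/unionP; exists C => //; rewrite inE eqxx.
have [xNW|xW] := boolP (x \notin W); first by rewrite -(top_anc axy xNW).
rewrite negbK in xW; rewrite (top_in xW).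
have [yW|yW] := boolP (y \in W).
  (* [y] is the second vertex of [C] and lies in [W], so it is not inner and must be the end. *)
  have Et : wend C = y.
    have : y \in rcons (winner C) (wend C) by rewrite -lastI inE eqxx.
    rewrite mem_rcons inE => /predU1P[->//|yC].
    by have := winner_notW Ccs CGc yC; rewrite yW.
  have [] := child_chain_connect Ccs CGc; rewrite Et // top_in // => con _.
  exact: closed_connect con.
have [c [e [cW upc cy tW]]] := top_child yW.
have xc : anc up x c.
  by case: (anc_total axy cy) => // /anc_W/(_ xW); rewrite (negPf cW).
have xNc : x <> c by move=> E; rewrite -E xW in cW.
(* [D] is the chain through the tree edge from [c] up to [top y]. It lies outside [Gc] because [c]
   is not in [W], so it stops on entering [W], at [top y]. *)
have [D [Dcs cD le]] := ci_cover I inJ xc xNc cy.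
have DGc : D \notin Gc by apply: contra cW => DGc; apply: winner_W cD.
have Et : wend D = top y.
  have [e' [u' []]] := ch_inner (ci_chain I Dcs) cD; rewrite upc => -[_ <-] _ [tD|//].
  by have := winner_notW Dcs DGc tD; rewrite tW.
have xt : anc up x (top y) := anc_parent xc xNc upc.
have st : anc up (wstart D) (top y) by rewrite -Et; apply: ch_anc (ci_chain I Dcs).
(* Both are ancestors of [top y], hence comparable, and [le] decides the order. *)
have sx : anc up (wstart D) x.
  case: (anc_total st xt) => // xs.
  have -> : wstart D = x; last exact: anc_refl.
  by apply: (pos_inj nt); apply/eqP; rewrite eqn_leq le (anc_pos nt xs).
have [] := child_chain_connect Dcs DGc; rewrite Et // => con [dt ds].
exact: closed_connect (tree_path_connect con ds dt sx xt).
Qed.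

(** Every edge of [G] joins comparable vertices, so by [top_edge_anc] only [e1] and [e2] can leave
    the preimage of [S] under [top]. *)
Lemma cut_disconnects v w : v \in W -> w \in W -> v \in S -> w \notin S ->
  ~ spanning_connected (~: [set e1; e2]).
Proof.
move=> vW wW vS wS con.
have clo : closed (adj (~: [set e1; e2])) [pred x | top x \in S].
  move=> x y /existsP[f]; rewrite !inE negb_or => /andP[/andP[fe1 fe2] /eqP xy].
  case: (edge_comparable nt xy) => axy; first exact: top_edge_anc xy axy fe1 fe2.
  by rewrite setUC in xy; apply/esym; apply: top_edge_anc xy axy fe1 fe2.
have := closed_connect clo (con v w); rewrite !inE !top_in // vS.
by rewrite (negPf wS).
Qed.

End Cut.

Lemma link_cut L e1 e2 es : link F L -> wedges L = e1 :: rcons es e2 ->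
  two_edge_cut e1 e2.
Proof.
move=> lL EL; have [ll _] := lL; have [pL LF dL] := ll.
case/and5P: (pL) => wL nL uL ub _.
split.
  move=> E; move: uL; rewrite EL E /= mem_rcons inE eqxx //.
have clo := winner_closed union_connect degr lL EL.
have e1F : e1 \in F by apply: LF; rewrite EL inE eqxx.
(* The two sides of the cut: having two edges, the link has an inner vertex, while its start is not
   inner. *)
have [v0 w0] : wstart L \in verts F /\ exists w, w \in winner L.
  case: (L) EL wL => v [|[e w] [|[e' w'] q]] //; first by case=> _; case: (es).
  case=> Ee _; rewrite /is_walk /= => /andP[/eqP vw _]; split.
    by apply/vertsP; exists e1; rewrite // -Ee vw set21.
  by exists w; rewrite inE eqxx.
have [w wLw] := w0.
have s0 : wstart L \notin winner L.
  by move: ub; case: (L) nL => v [|[e' w'] q] //= _ /andP[].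
apply: (@cut_disconnects [in winner L] e1 e2 clo _ w (wstart L)) => //.
- move=> f x y fF fe1 fe2 xy; apply/idP/idP => inL.
    exact: winner_edge_winner ll EL inL fF xy fe1 fe2.
  by rewrite setUC in xy; apply: winner_edge_winner ll EL inL fF xy fe1 fe2.
- by apply/verts_W/deg2_verts/dL.
- exact: verts_W.
Qed.

End ParentClosed.

(** * The root, the first chain and the conclusion *)

Lemma theta_branch_deg (G : mgraph) (F : {set edge G})
    (b : vertex theta -> vertex G) x :
  subdivision F b -> 3 <= deg F (b x).
Proof.
case=> _ [P [pathP _ disjP FE]].
(* Each edge of [theta] meets both of its vertices, so each of the three paths has an edge at [b x];
   these edges differ as the paths are edge-disjoint. *)
have inc k : exists2 e, e \in wedges (P k) & b x \in ends e.
  have [/and5P[wP nP _ _ _] [u [v [uv sP tP]]]] := pathP k.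
  have : x \in ends k by rewrite inE.
  rewrite uv !inE => /orP[]/eqP->; [rewrite -sP | rewrite -tP].
    case: (P k) wP nP => a [|[e w] q] //; rewrite /is_walk /= => /andP[/eqP aw _] _.
    by exists e; rewrite ?inE ?eqxx // aw set21.
  case: (P k) wP nP => a p; case/lastP: p => [|q [e w]] //.
  rewrite /is_walk /= -cats1 walk_from_cat /= andbT => /andP[_ /eqP aw] _.
  exists e; first by rewrite /wedges /unzip1 map_cat mem_cat inE eqxx orbT.
  by rewrite /wend /unzip2 map_cat last_cat /= aw set22.
pose inc_edge k e := (e \in wedges (P k)) && (b x \in ends e).
have ex_inc k : exists e, inc_edge k e.
  by have [e eP xe] := inc k; exists e; apply/andP.
pose g k := xchoose (ex_inc k).
have gP k : inc_edge k (g k) := xchooseP (ex_inc k).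
have g_inj : injective g.
  move=> k l E; apply: contraTeq isT => /disjP[_ /pred0P/(_ (g k))] /=.
  by have /andP[-> _] := gP k; rewrite E; have /andP[-> _] := gP l.
rewrite -[3]card_ord -cardsT -(card_imset _ g_inj).
apply/subset_leq_card/subsetP=> _ /imsetP[k _ ->].
have /andP[gk xg] := gP k; rewrite inE xg andbT.
by apply/FE; exists k.
Qed.

Lemma subset_deg (G : mgraph) (F F' : {set edge G}) v :
  F \subset F' -> deg F v <= deg F' v.
Proof.
move=> sF; apply/subset_leq_card/subsetP=> e; rewrite !inE => /andP[eF ->].
by rewrite (subsetP sF).
Qed.

(** A chain with an edge at [r] must start there: [r] has no parent, so is not inner, and a chain
    ending in [r] starts at an ancestor of it. The first chain starts no later, hence at [r], and it
    is closed. *)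
Lemma first_chain_root (G : mgraph) (r : vertex G) pos up disc J vis C1 cs :
  normal_tree r pos up -> chains_inv pos up disc J (vis, C1 :: cs) ->
  r \in verts (union_of (C1 :: cs)) -> wend C1 = r.
Proof.
move=> nt I /bigcupP[e]; rewrite inE => /hasP[C Ccs eC] re.
have spC := ci_chain I Ccs; case/and5P: (ch_path spC) => wC /eqP nC _ _ _.
have sC : wstart C = r.
  have := walk_edge_ends wC eC re; rewrite (path_vertices nC) inE mem_rcons inE.
  case/or3P=> [/eqP->//|/eqP Et|rC].
    by apply: (anc_anti nt); [rewrite Et; apply: ch_anc spC | apply: (anc_root nt)].
  by have [f [u []]] := ch_inner spC rC; rewrite (up_root nt).
have [-> /(_ C Ccs)] := ci_first I erefl; rewrite sC => le.
apply: (pos_inj nt); apply/eqP; rewrite eqn_leq le.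
exact: (anc_pos nt (anc_root nt _)).
Qed.

Theorem theorem2 (G : mgraph) (r : vertex G) (disc : seq (vertex G))
    (up : forest G) (bk : vertex G -> seq (edge G * vertex G))
    (C1 C2 : walk G) (cs Gc : seq (walk G))
    (mindegG : min_degree_ge G 3)
    (G2ec : edge_connected G 2)
    (dfsT : dfs_tree r disc up)
    (bkP : back_edge_lists up bk)
    (csE : chain_decomposition up disc bk = cs)
    (csC12 : take 2 cs = [:: C1; C2])
    (thetaC12 : exists b : vertex theta -> vertex G,
       subdivision (union_of [:: C1; C2]) b /\
       [set b x | x in [set: vertex theta]] = [set r; wend C2])
    (GcS : {subset Gc <= cs})
    (GcC1 : C1 \in Gc) (GcC2 : C2 \in Gc)
    (Gcpc : parent_closed up r C1 cs Gc)
    (noMader : forall C : walk G, child_chain up r C1 cs Gc C ->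
       ~ mader_path (union_of Gc) C)
    (exChild : exists C : walk G, child_chain up r C1 cs Gc C) :
  forall (L : walk G) (e1 e2 : edge G) (es : seq (edge G)),
    link (union_of Gc) L -> wedges L = e1 :: rcons es e2 ->
    two_edge_cut e1 e2.
Proof.
have conG : spanning_connected [set: edge G].
  by have := G2ec.2 set0; rewrite cards0 setC0; apply.
have [ud alld nt] := dfs_tree_normal conG dfsT.
have [J Jall I] := process_vertices_inv nt bkP ud alld (frefl _).
rewrite /chain_decomposition in csE.
case: (foldl _ _ _) csE I => vis cs' /= -> I.
(* [r] is a branch vertex of the subdivision formed by [C1] and [C2], which [Gc] contains. *)
have degr : 3 <= deg (union_of Gc) r.
  have [b [sub /setP/(_ r)]] := thetaC12; rewrite set21 => /imsetP[x _ ->].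
  apply: leq_trans (theta_branch_deg x sub) _; apply/subset_deg/subsetP=> e.
  rewrite !inE /= orbF => eC; apply/hasP.
  by case/orP: eC => eC; [exists C1 | exists C2].
have rV : r \in verts (union_of Gc).
  have /card_gt0P[e] := leq_trans (isT : 0 < 3) degr.
  by rewrite inE => /andP[eF re]; apply/vertsP; exists e.
have C1r : wend C1 = r.
  case: cs csC12 I GcS {Gcpc noMader exChild} => [|C cs] // [-> _] I GcS.
  apply: (first_chain_root nt I); case/vertsP: rV => e; rewrite inE.
  case/hasP=> C0 /GcS C0cs eC0 re; apply/vertsP; exists e => //.
  by rewrite inE; apply/hasP; exists C0.
have Jback v e w : back_edge up v e w -> (v, (e, w)) \in J.
  by move=> be; apply: Jall; rewrite (bkP v).2.
have degr2 : deg (union_of Gc) r <> 2 by move=> E; rewrite E in degr.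
move=> L e1 e2 es.
exact: (link_cut nt I Jback GcS GcC1 C1r Gcpc noMader rV degr2).
Qed.
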